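(* Let $d\geq 3$ be an integer, let $R>0$, and let $\partial B(0,R)=\{\omega\in\mathbb{R}^d : |\omega|=R\}$. Let $g:\partial B(0,R)\to\mathbb{R}$ be a Borel measurable function such that $$g(\omega)+g(\omega_* )=g(\omega')+g(\omega_*')$$ for all $\omega,\omega_*,\omega',\omega_*'\in\partial B(0,R)$ satisfying $$\omega+\omega_*=\omega'+\omega_*'.$$ Then there are $A\in\mathbb{R}$ and $B\in\mathbb{R}^d$ such that $$g(\omega)=A+B\cdot\omega$$ for all $\omega\in\partial B(0,R)$.
   Context: Here $|\cdot|$ denotes the Euclidean norm and $\cdot$ the Euclidean inner product on $\mathbb{R}^d$. The function $g$ is defined everywhere on the sphere, and both the functional equation and the conclusion hold pointwise everywhere (not merely almost everywhere). *)

(* Defs.v *)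
From HB Require Import structures.
From mathcomp Require Import all_boot all_order all_algebra.
From mathcomp Require Import all_classical all_reals all_analysis.
Set Implicit Arguments.
Unset Strict Implicit.
Unset Printing Implicit Defensive.
Import Order.TTheory GRing.Theory Num.Theory.
Import numFieldNormedType.Exports.
Local Open Scope classical_set_scope.
Local Open Scope ring_scope.

Definition dotv (R : realType) (d : nat) (u v : 'rV[R]_d) : R :=
  \sum_(i < d) u ord0 i * v ord0 i.

(* The library norm on 'rV[R]_d is the sup norm, hence this Euclidean one;
   both norms induce the same topology. *)
Definition enorm (R : realType) (d : nat) (u : 'rV[R]_d) : R :=
  Num.sqrt (dotv u u).

Definition esphere (R : realType) (d : nat) (r : R) : set 'rV[R]_d :=
  [set w | enorm w = r].
Arguments esphere {R} d r _.

(* A function on D is represented by a total function whose values off D are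
   irrelevant.  The source carries the sigma-algebra generated by the open sets
   of 'rV[R]_d, and measurable_fun asks that the sets D `&` g @^-1` Y be Borel;
   for Borel D this is measurability for the Borel sigma-algebra of the
   subspace D. *)
Definition borel_measurable_on (R : realType) (d : nat)
    (D : set 'rV[R]_d) (g : 'rV[R]_d -> R) : Prop :=
  @measurable_fun _ _ (g_sigma_algebraType (@open 'rV[R]_d)) R D g.

(* Main.v *)
Require Import Defs.
From mathcomp Require Import all_boot all_order all_algebra.
From mathcomp Require Import all_classical all_reals all_analysis.
From mathcomp Require Import measurable_realfun ring lra.
Import Order.TTheory GRing.Theory Num.Theory.
Import numFieldNormedType.Exports.
Local Open Scope classical_set_scope.
Local Open Scope ring_scope.
Set Implicit Arguments.
Unset Strict Implicit.

(** The hypothesis says that g w + g w1 depends only on the sum w + w1, so it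
defines a function G on the closed ball of radius 2r, the set of all such sums,
and g w = G (2w) / 2 on the sphere.  It therefore suffices to show that
H = G - G 0 is the restriction of a linear form.

The geometric heart of the argument is that H is orthogonally additive
([chord_sum_orthogonal]).  If x and y are orthogonal and z is orthogonal to
both, which is where d >= 3 enters, then for a suitable length of z the points
[w = (x + y)/2 + z], [w1 = (x - y)/2 - z] and [w3 = (x + y)/2 - z] lie on the
sphere, and [x = w + w1], [y = w3 + (- w1)], [x + y = w + w3].  Hence G x + G y
and G (x + y) differ by g w1 + g (- w1) = G 0.  In the same way H is odd
([chord_sumN]).

Orthogonal additivity forces additivity along each ray
([orthogonally_additive_ray]): for orthonormal e, f the vectors
[a e + sqrt(ab) f] and [b e - sqrt(ab) f] are orthogonal with sum [(a + b) e],
and the two contributions of [sqrt(ab) f] cancel because H is odd.  On a ray H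
is thus a measurable solution of Cauchy's equation on an interval, hence linear
([additive_measurable_linear]).  Decomposing a vector along the orthonormal
standard basis gives linearity of H on the whole ball
([orthogonally_additive_linear]).

Cauchy's equation on [[0, L]] is solved as follows.  The sets where |h| <= n
exhaust the interval, so one of them has measure more than 3L/4; it then meets
its translate by any x in [[0, L/4]] ([meets_shift]), which writes x as a
difference of two of its points and bounds h near 0.  Subtracting the linear
function with the same value at L leaves a bounded solution k with k L = 0; its
values can be doubled indefinitely, so k = 0. *)

(** * Cauchy's functional equation on an interval *)
Lemma lebesgue_measure_shift (R : realType) (x : R) (A : set R) :
  measurable A -> lebesgue_measure [set t | A (t - x)] = lebesgue_measure A.
Proof.
have mf : measurable_fun [set: R] (fun t : R => t - x).
  exact: measurable_funB.
move=> mA; transitivity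
    (pushforward lebesgue_measure ((fun t => t - x) : _ -> measurableTypeR R) A).
  by [].
apply/esym/lebesgue_measure_unique => //= _ [[a b]] _ <-.
rewrite /pushforward.
have -> : (fun t => t - x) @^-1` `]a, b]%classic = `]a + x, b + x]%classic.
  by apply/seteqP; split => t /=; rewrite !in_itv/= ltrBrDr lerBlDr.
rewrite !lebesgue_measure_itv/= !lte_fin ltrD2r.
by case: ifP => // _; rewrite -!EFinB; congr EFin; ring.
Qed.

(** Otherwise A and its translate would be disjoint subsets of an interval of
length 5L/4, each of measure more than 3L/4. *)
Lemma meets_shift (R : realType) (L x : R) (A : set R) :
  0 < L -> measurable A -> A `<=` `[0, L]%classic ->
  ((3 / 4 * L)%:E < lebesgue_measure A)%E -> 0 <= x <= L / 4 ->
  exists2 s, A s & A (s - x).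
Proof.
move=> L0 mA AL muA /andP[x0 xL]; apply: contrapT => nex.
pose B : set R := [set t | A (t - x)].
have mf : measurable_fun [set: R] (fun t : R => t - x).
  exact: measurable_funB.
have mB : measurable B.
  by rewrite -[X in measurable X]setTI; exact: mf.
have disj : A `&` B = set0.
  by rewrite -subset0 => s [As Asx]; apply: nex; exists s.
have sub : A `|` B `<=` `[0, 5 / 4 * L]%classic.
  by move=> t [/AL|/AL] /=; rewrite !in_itv/= => /andP[? ?]; apply/andP; split; lra.
have le : (lebesgue_measure (A `|` B) <=
           lebesgue_measure `[0%R, (5 / 4 * L)%R]%classic)%E.
  by apply: le_measure => //; rewrite inE; [exact: measurableU|exact: measurable_itv].
have muAB : (lebesgue_measure (A `|` B) =
             lebesgue_measure A + lebesgue_measure B)%E by exact: measureU.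
have muB : lebesgue_measure B = lebesgue_measure A.
  exact: lebesgue_measure_shift.
move: le; rewrite muAB muB.
rewrite lebesgue_measure_itv/= lte_fin ifT; last by lra.
rewrite oppr0 adde0 leNgt => /negP; apply.
apply: (@lt_trans _ _ ((3 / 4 * L)%:E + (3 / 4 * L)%:E)%E).
  by rewrite -EFinD lte_fin; lra.
by rewrite lteD.
Qed.

(** Continuity from below of the measure, applied to the sublevel sets of |h|,
whose union is the whole interval since h is real-valued. *)
Lemma large_bounded_sublevel (R : realType) (L : R) (h : R -> R) :
  0 < L -> measurable_fun `[0, L]%classic h ->
  exists n : nat, let A := `[0, L] `&` [set t | `|h t| <= n%:R] in
    measurable A /\ ((3 / 4 * L)%:E < lebesgue_measure A)%E.
Proof.
move=> L0 mh.
pose A (n : nat) : set R := `[0, L] `&` [set t | `|h t| <= n%:R].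
have mA n : measurable (A n).
  have mY : measurable [set` `[- n%:R, n%:R : R]] by exact: measurable_itv.
  have -> : A n = `[0, L] `&` h @^-1` [set` `[- n%:R, n%:R : R]].
    by rewrite /A; apply/seteqP; split => t /=; rewrite !in_itv/= ler_norml.
  by apply: mh => //; exact: measurable_itv.
have UA : \bigcup_n A n = `[0, L]%classic.
  apply/seteqP; split => [t [n _ []]//|t tL].
  exists (Num.truncn `|h t|).+1 => //; split => //=.
  exact/ltW/truncnS_gt.
have cA : lebesgue_measure (A n) @[n --> \oo] --> lebesgue_measure `[0, L]%classic.
  rewrite -UA; apply: (@nondecreasing_cvg_mu _ _ _ lebesgue_measure A) => //.
    by rewrite UA; exact: measurable_itv.
  move=> m n mn; apply/subsetPset => t [tL /= ht]; split => //=.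
  by apply: le_trans ht _; rewrite ler_nat.
apply: contrapT => /forallNP nA.
have : (lebesgue_measure `[0%R, L]%classic <= (3 / 4 * L)%:E)%E.
  rewrite -(cvg_lim _ cA)//; apply: lime_le; first by apply/cvg_ex; eexists; exact: cA.
  apply: nearW => n /=; rewrite leNgt; apply/negP => lt.
  by apply: (nA n); split; [exact: mA|exact: lt].
rewrite lebesgue_measure_itv/= lte_fin L0 oppr0 adde0 lee_fin; lra.
Qed.

(** The point of the proof is that measurability bounds h near 0.  Doubling
arguments then finish without leaving the interval, on which alone the equation
is available. *)
Lemma additive_measurable_linear (R : realType) (L : R) (h : R -> R) :
  0 < L ->
  (forall a b, 0 <= a -> 0 <= b -> a + b <= L -> h (a + b) = h a + h b) ->
  measurable_fun `[0, L]%classic h ->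
  forall t, 0 <= t <= L -> h t = t / L * h L.
Proof.
move=> L0 hD mh.
have [n [mA muA]] := large_bounded_sublevel L0 mh.
have hquarter x : 0 <= x <= L / 4 -> `|h x| <= n%:R + n%:R.
  move=> xL; have [|s [/= sL hs] [/= sxL hsx]] := meets_shift L0 mA _ muA xL.
    by move=> t [].
  move: sL sxL; rewrite !in_itv/= => /andP[s0 sL] /andP[sx0 sxL].
  have -> : h x = h s - h (s - x).
    by rewrite -{1}(subrK x s) hD//; [ring|lra|lra].
  by rewrite (le_trans (ler_normB _ _))// lerD.
(* Normalising at L makes L a period of k, which the doubling step uses. *)
pose k t := h t - t / L * h L.
have kD a b : 0 <= a -> 0 <= b -> a + b <= L -> k (a + b) = k a + k b.
  by move=> a0 b0 ab; rewrite /k hD//; field; lra.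
have kL : k L = 0 by rewrite /k divff ?gt_eqF// mul1r subrr.
(* The factor 8 = 4 * 2: t is four times t/4, where |h| <= n + n. *)
pose M := 8 * n%:R + `|h L|.
have kM t : 0 <= t <= L -> `|k t| <= M.
  move=> /andP[t0 tL]; rewrite (le_trans (ler_normB _ _))// lerD//.
    have h2 s : 0 <= s -> s + s <= L -> h (s + s) = 2 * h s.
      by move=> s0 sL; rewrite hD//; ring.
    have {1}-> : t = (t / 4 + t / 4) + (t / 4 + t / 4) by field.
    rewrite !h2; [|lra..].
    have := hquarter (t / 4); rewrite !normrM ger0_norm//.
    have -> : 0 <= t / 4 <= L / 4 by apply/andP; split; lra.
    by move=> /(_ isT); lra.
  rewrite normrM ler_piMl// ger0_norm ?divr_ge0//; last by lra.
  by rewrite ler_pdivrMr// mul1r.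
have kdouble t : 0 <= t <= L -> exists2 s, 0 <= s <= L & k s = 2 * k t.
  move=> /andP[t0 tL]; have [tt|tt] := leP (t + t) L.
    by exists (t + t); [apply/andP; split; lra|rewrite kD//; ring].
  (* 2t has left the interval: come back by subtracting the period L. *)
  exists (t + t - L); first by apply/andP; split; lra.
  have e1 : k t + k (L - t) = 0.
    by rewrite -kD; [rewrite -[RHS]kL; congr k; ring|lra..].
  have e2 : k t = k (t + t - L) + k (L - t).
    by rewrite -kD; [congr k; ring|lra..].
  lra.
have kpow m t : 0 <= t <= L -> `|k t| * 2 ^+ m <= M.
  elim: m t => [|m IH] t tL; first by rewrite mulr1 kM.
  have [s sL ks] := kdouble t tL.
  have := IH s sL; rewrite ks normrM ger0_norm// exprS.
  by move=> ?; rewrite mulrCA mulrA.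
move=> t tL; apply/eqP; rewrite -subr_eq0 -/(k t) -normr_le0 leNgt; apply/negP.
move=> kt0; pose m := (Num.truncn (M / `|k t|)).+1.
have : M / `|k t| < m%:R by exact: truncnS_gt.
rewrite ltr_pdivrMr// ltNge => /negP; apply.
apply: le_trans (kpow m t tL); rewrite mulrC ler_pM2l// -natrX ler_nat.
exact/ltnW/ltn_expl.
Qed.

(** * Euclidean geometry of row vectors *)

Section Euclid.
Variables (R : realType) (d : nat).
Implicit Types (u v w x y z : 'rV[R]_d) (a b : R).

Lemma dotvC u v : dotv u v = dotv v u.
Proof. by apply: eq_bigr => i _; rewrite mulrC. Qed.

Lemma dotvDl u v w : dotv (u + v) w = dotv u w + dotv v w.
Proof. by rewrite -big_split; apply: eq_bigr => i _; rewrite mxE mulrDl. Qed.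

Lemma dotvZl a u v : dotv (a *: u) v = a * dotv u v.
Proof. by rewrite mulr_sumr; apply: eq_bigr => i _; rewrite mxE mulrA. Qed.

Lemma dotvNl u v : dotv (- u) v = - dotv u v.
Proof. by rewrite -scaleN1r dotvZl mulN1r. Qed.

Lemma dotvDr u v w : dotv u (v + w) = dotv u v + dotv u w.
Proof. by rewrite dotvC dotvDl !(dotvC _ u). Qed.

Lemma dotvZr a u v : dotv u (a *: v) = a * dotv u v.
Proof. by rewrite dotvC dotvZl dotvC. Qed.

Lemma dotvNr u v : dotv u (- v) = - dotv u v.
Proof. by rewrite dotvC dotvNl dotvC. Qed.

Lemma dot0v v : dotv 0 v = 0.
Proof. by rewrite -(scale0r 0) dotvZl mul0r. Qed.

Lemma dotv0 u : dotv u 0 = 0.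
Proof. by rewrite dotvC dot0v. Qed.

Definition dotv_bilinE := (dotvDl, dotvDr, dotvZl, dotvZr, dotvNl, dotvNr).

Lemma dotv_ge0 u : 0 <= dotv u u.
Proof. by apply: sumr_ge0 => i _; rewrite -expr2 sqr_ge0. Qed.

Lemma dotv_gt0 u : u != 0 -> 0 < dotv u u.
Proof.
move=> u0; rewrite lt0r dotv_ge0 andbT; apply: contraNneq u0 => uu0.
apply/eqP/rowP => i; rewrite mxE; apply/eqP; rewrite -sqrf_eq0 expr2.
by move/psumr_eq0P: uu0 => ->// j _; rewrite -expr2 sqr_ge0.
Qed.

Lemma dotv_delta i j : dotv ('e_i : 'rV[R]_d) 'e_j = (i == j)%:R.
Proof.
rewrite /dotv (bigD1 i)//= big1 => [|k ki].
  by rewrite !mxE !eqxx mul1r addr0.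
by rewrite !mxE (negPf ki) andbF mul0r.
Qed.

Lemma esphereE r w : 0 <= r -> esphere d r w <-> dotv w w = r ^+ 2.
Proof.
move=> r0; rewrite /esphere /enorm /=; split => [<-|->].
  by rewrite sqr_sqrtr ?dotv_ge0.
by rewrite sqrtr_sqr ger0_norm.
Qed.

(** The d by 2 matrix with columns x and y has rank at most 2 < d, hence a
nonzero left kernel. *)
Lemma exists_unit_orthogonal x y : (3 <= d)%N ->
  exists z, [/\ dotv z z = 1, dotv x z = 0 & dotv y z = 0].
Proof.
move=> d3; pose M : 'M[R]_(d, 1 + 1) := row_mx x^T y^T.
have kM0 : kermx M != 0.
  rewrite -mxrank_eq0 mxrank_ker subn_eq0 -ltnNge.
  by rewrite (leq_ltn_trans (rank_leq_col M)).
have /rowV0Pn[v /sub_kermxP] := kM0.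
rewrite mul_mx_row -(row_mx0 R 1 1 1) => /eq_row_mx[vx vy] v0.
have dotE u : v *m u^T = 0 -> dotv u v = 0.
  move=> /matrixP /(_ ord0 ord0); rewrite !mxE => e.
  by rewrite dotvC -[RHS]e; apply: eq_bigr => i _; rewrite mxE.
have vv0 := dotv_gt0 v0.
exists ((Num.sqrt (dotv v v))^-1 *: v); rewrite !dotv_bilinE.
rewrite (dotE x)// (dotE y)// !mulr0.
split => //; rewrite mulrA -invfM -expr2 sqr_sqrtr ?dotv_ge0// mulVf//.
by rewrite gt_eqF.
Qed.


Lemma continuous_dotv_diag : continuous (fun u => dotv u u).
Proof.
have H (s : seq 'I_d) : continuous (fun u => \sum_(i <- s) u ord0 i * u ord0 i).
  elim: s => [|i s IH].
    have -> : (fun u => \sum_(i <- [::]) u ord0 i * u ord0 i) = cst 0.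
      by apply/funext => u; rewrite big_nil.
    exact: cst_continuous.
  have -> : (fun u => \sum_(k <- i :: s) u ord0 k * u ord0 k) =
      (fun u => u ord0 i * u ord0 i + \sum_(k <- s) u ord0 k * u ord0 k).
    by apply/funext => u; rewrite big_cons.
  move=> u; have ci : continuous (fun v : 'rV[R]_d => v ord0 i).
    exact: coord_continuous.
  have cii := continuousM (ci u) (ci u).
  exact: (@continuousD R _ _ _ _ u cii (IH u)).
exact: (H (index_enum _)).
Qed.

Lemma continuous_rowP (f : R -> 'rV[R]_d) :
  (forall i, continuous (fun t => f t ord0 i)) -> continuous f.
Proof.
move=> cf t A [P fP sPA]; rewrite /nbhs/=.
apply: (@filterS _ (nbhs t) _ _ _ (fun s => sPA (f s))).
have : \forall s \near t, forall i : 'I_d, P ord0 i (f s ord0 i).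
  apply: (@filter_forall _ _ (fun i s => P ord0 i (f s ord0 i)) (nbhs t)) => i.
  exact: (cf i t _ (fP ord0 i)).
by apply: (@filterS _ (nbhs t)) => s Ps j i; rewrite ord1.
Qed.

End Euclid.

(** * Orthogonally additive functions on a ball *)

Section OrthogonallyAdditive.
Variables (R : realType) (d : nat) (rho : R) (H : 'rV[R]_d -> R).
Hypotheses (d3 : (3 <= d)%N) (rho0 : 0 < rho).
Hypothesis HD : forall x y, dotv x y = 0 ->
  dotv x x + dotv y y <= rho ^+ 2 -> H (x + y) = H x + H y.
Hypothesis HN : forall x, dotv x x <= rho ^+ 2 -> H (- x) = - H x.

(** The right triangle with hypotenuse (a + b) e and altitude sqrt(ab) f: by the
geometric mean theorem its legs are a e + sqrt(ab) f and b e - sqrt(ab) f. *)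
Lemma orthogonally_additive_ray e a b : dotv e e = 1 ->
  0 <= a -> 0 <= b -> a + b <= rho -> H ((a + b) *: e) = H (a *: e) + H (b *: e).
Proof.
move=> e1 a0 b0 ab.
have [f [f1 ef _]] := exists_unit_orthogonal e e d3.
pose c := Num.sqrt (a * b).
have cc : c * c = a * b by rewrite -expr2 sqr_sqrtr ?mulr_ge0.
have ab2 : (a + b) ^+ 2 <= rho ^+ 2 by rewrite lerXn2r// nnegrE; lra.
have ab0 := mulr_ge0 a0 b0; have a20 := sqr_ge0 a; have b20 := sqr_ge0 b.
have -> : (a + b) *: e = (a *: e + c *: f) + (b *: e - c *: f).
  by rewrite scalerDl addrACA subrr addr0.
have dfe : dotv f e = 0 by rewrite dotvC.
rewrite HD ?dotv_bilinE ?e1 ?f1 ?ef ?dfe; last 2 first.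
- by lra.
- by lra.
rewrite [H (a *: e + _)]HD ?[H (b *: e - _)]HD ?HN ?dotv_bilinE ?e1 ?f1 ?ef; [ring|lra..].
Qed.

Hypothesis mH : forall i : 'I_d,
  measurable_fun `[0, rho]%classic (fun t : R => H (t *: 'e_i)).

Lemma orthogonally_additive_axis i t : `|t| <= rho ->
  H (t *: 'e_i) = t / rho * H (rho *: 'e_i).
Proof.
have pos s : 0 <= s <= rho -> H (s *: 'e_i) = s / rho * H (rho *: 'e_i).
  apply: (additive_measurable_linear rho0 _ (mH i)) => a b a0 b0 ab.
  by rewrite orthogonally_additive_ray// dotv_delta eqxx.
move=> tr; have [t0|/ltW t0] := leP 0 t.
  by apply: pos; rewrite t0 -(ger0_norm t0).
have -> : t *: 'e_i = - (- t *: 'e_i) :> 'rV[R]_d by rewrite scaleNr opprK.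
rewrite ler0_norm// in tr.
rewrite HN; first by rewrite pos ?oppr_ge0 ?t0//; ring.
rewrite !dotv_bilinE dotv_delta eqxx mulr1; nra.
Qed.

(** Adding one coordinate at a time: each partial sum of the expansion of x in
the standard basis is orthogonal to the next term, and no partial sum is longer
than x, so all of them stay in the ball. *)
Lemma orthogonally_additive_linear x : dotv x x <= rho ^+ 2 ->
  H x = dotv (\row_i (H (rho *: 'e_i) / rho)) x.
Proof.
move=> xx.
pose P (s : seq 'I_d) : 'rV[R]_d := \row_i (if i \in s then x ord0 i else 0).
have PP s : dotv (P s) (P s) <= rho ^+ 2.
  apply: le_trans xx; apply: ler_sum => i _; rewrite !mxE.
  by case: ifP => // _; rewrite mulr0 -expr2 sqr_ge0.
have H0 : H 0 = 0.
  have := @HD 0 0; rewrite addr0 dot0v addr0 => /(_ erefl (sqr_ge0 _)); lra.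
have HP s : uniq s -> H (P s) = \sum_(i <- s) H (x ord0 i *: 'e_i).
  elim: s => [_|a s IH /= /andP[as_ us]].
    by rewrite big_nil -[RHS]H0; congr H; apply/rowP => i; rewrite !mxE.
  have Pas : P (a :: s) = x ord0 a *: 'e_a + P s.
    apply/rowP => i; rewrite !mxE in_cons eqxx/=; have [->|ia] := eqVneq i a.
      by rewrite (negPf as_) mulr1 addr0.
    by rewrite mulr0 add0r.
  have orth : dotv (x ord0 a *: 'e_a) (P s) = 0.
    apply: big1 => i _; rewrite !mxE eqxx/=; have [->|ia] := eqVneq i a.
      by rewrite (negPf as_) mulr0.
    by rewrite mulr0 mul0r.
  rewrite big_cons -IH// Pas HD//.
  have := PP (a :: s); rewrite Pas dotvDl !dotvDr [dotv (P s) (_ *: _)]dotvC orth.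
  by rewrite addr0 add0r.
have {1}-> : x = P (index_enum 'I_d).
  by apply/rowP => i; rewrite mxE mem_index_enum.
rewrite HP ?index_enum_uniq//; apply: eq_bigr => i _.
rewrite mxE orthogonally_additive_axis; first by ring.
rewrite -(ler_pXn2r (ltn0Sn 1)) ?nnegrE ?(ltW rho0)//.
apply: le_trans xx; rewrite real_normK ?num_real// /dotv (bigD1 i)//= -expr2 lerDl.
by apply: sumr_ge0 => j _; rewrite -expr2 sqr_ge0.
Qed.
End OrthogonallyAdditive.

(** * Sums over the endpoints of a chord of the sphere *)

Section Chords.
Variables (R : realType) (d : nat) (r : R) (g : 'rV[R]_d -> R).
Hypotheses (d3 : (3 <= d)%N) (r0 : 0 < r).
Hypothesis hg : forall w w1 w' w1' : 'rV[R]_d,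
  esphere d r w -> esphere d r w1 -> esphere d r w' -> esphere d r w1' ->
  w + w1 = w' + w1' -> g w + g w1 = g w' + g w1'.

(** The endpoints w and w1 of a chord with midpoint x/2 are chosen arbitrarily;
the value does not depend on them by [chord_sumE].  For x outside the ball of
radius 2r there is no such chord and the value is meaningless. *)
Definition chord_sum (x : 'rV[R]_d) : R :=
  let p := xget (0, 0) [set p : 'rV[R]_d * 'rV[R]_d |
    [/\ esphere d r p.1, esphere d r p.2 & p.1 + p.2 = x]] in
  g p.1 + g p.2.

Lemma chord_sumE w w1 : esphere d r w -> esphere d r w1 ->
  chord_sum (w + w1) = g w + g w1.
Proof.
move=> sw sw1; rewrite /chord_sum; case: xgetP => [p -> [s1 s2 e]|/(_ (w, w1))].
  exact: hg.
by case.
Qed.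

Lemma esphereN w : esphere d r w -> esphere d r (- w).
Proof. by rewrite !esphereE ?ltW// !dotv_bilinE opprK. Qed.

(** The vectors (x + y)/2 and (x - y)/2 have the same squared length
(|x|^2 + |y|^2)/4, and s is what the orthogonal direction z must contribute to
reach the sphere.  The bound on x and y makes the radicand nonnegative. *)
Lemma chord_endpoints x y z : dotv x y = 0 -> dotv x z = 0 -> dotv y z = 0 ->
  dotv z z = 1 -> dotv x x + dotv y y <= (2 * r) ^+ 2 ->
  let s := Num.sqrt (r ^+ 2 - (dotv x x + dotv y y) / 4) in
  esphere d r (2^-1 *: (x + y) + s *: z) /\ esphere d r (2^-1 *: (x - y) - s *: z).
Proof.
move=> xy xz yz zz le s.
have ss : s * s = r ^+ 2 - (dotv x x + dotv y y) / 4.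
  by rewrite -expr2 sqr_sqrtr//; move: le; rewrite exprMn; lra.
have yx : dotv y x = 0 by rewrite dotvC.
have zx : dotv z x = 0 by rewrite dotvC.
have zy : dotv z y = 0 by rewrite dotvC.
split; apply/esphereE; rewrite ?(ltW r0)// !dotv_bilinE ?xy ?xz ?yx ?yz ?zx ?zy ?zz.
all: by lra.
Qed.

(** With w, w1 the endpoints given by z and w3 the mirror image of w in the
hyperplane orthogonal to z, one has x + y = w + w3, x = w + w1, y = - w1 + w3 and 0 = w1 - w1. *)
Lemma chord_sum_orthogonal x y : dotv x y = 0 ->
  dotv x x + dotv y y <= (2 * r) ^+ 2 ->
  chord_sum (x + y) + chord_sum 0 = chord_sum x + chord_sum y.
Proof.
move=> xy le; have [z [zz xz yz]] := exists_unit_orthogonal x y d3.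
have [] := chord_endpoints xy xz yz zz le.
set s := Num.sqrt _; set w := _ + _; set w1 := _ - _ => sw sw1.
have [] := @chord_endpoints x y (- z); rewrite ?dotv_bilinE ?xz ?yz ?oppr0 ?opprK//.
rewrite -/s scalerN opprK; set w3 := _ + _ => sw3 _.
have -> : x + y = w + w3 by apply/rowP => i; rewrite !mxE; field.
have -> : x = w + w1 by apply/rowP => i; rewrite !mxE; field.
have -> : y = - w1 + w3 by apply/rowP => i; rewrite !mxE; field.
rewrite -(subrr w1) !chord_sumE//; try exact: esphereN.
ring.
Qed.

(** If x = w + w1, both sides are the sum of g over w, w1, - w and - w1. *)
Lemma chord_sumN x : dotv x x <= (2 * r) ^+ 2 ->
  chord_sum x + chord_sum (- x) = chord_sum 0 + chord_sum 0.
Proof.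
move=> le; have [z [zz xz _]] := exists_unit_orthogonal x x d3.
have le0 : dotv x x + dotv (0 : 'rV[R]_d) 0 <= (2 * r) ^+ 2.
  by rewrite dot0v addr0.
have [] := chord_endpoints (dotv0 x) xz (dot0v z) zz le0.
set w := _ + _; set w1 := _ - _ => sw sw1.
have -> : x = w + w1 by apply/rowP => i; rewrite !mxE; field.
rewrite opprD -{1}(subrr w) -(subrr w1) !chord_sumE//; try exact: esphereN.
ring.
Qed.

(** The sphere is Borel, being closed, so the measurability of g on it can be
pulled back along any continuous curve drawn on the sphere. *)
Lemma measurable_comp_sphere (D : set R) (f : R -> 'rV[R]_d) :
  borel_measurable_on (esphere d r) g -> continuous f ->
  (forall t, D t -> esphere d r (f t)) -> measurable_fun D (g \o f).
Proof.
move=> mg cf fD.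
have mS : <<s (@open 'rV[R]_d) >> (esphere d r).
  have -> : esphere d r = ~` [set w : 'rV[R]_d | dotv w w != r ^+ 2].
    apply/seteqP; split => w /=; rewrite (esphereE _ (ltW r0)).
      by move=> ->; rewrite eqxx.
    by move=> /negP; rewrite negbK => /eqP.
  rewrite -setTD; apply: sigma_algebraCD; apply: sub_sigma_algebra.
  apply: (@open_comp _ _ (fun u : 'rV[R]_d => dotv u u) [set y | y != r ^+ 2]).
    by move=> u _; exact: continuous_dotv_diag.
  exact: open_neq.
have mf : @measurable_fun _ _ R (g_sigma_algebraType (@open 'rV[R]_d)) setT f.
  refine (@measurability _ _ R (g_sigma_algebraType (@open 'rV[R]_d)) setT f
    (@open 'rV[R]_d) _ _) => //.
  move=> _ [B oB <-]; rewrite setTI; apply: open_measurable.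
  by apply: open_comp => // t _; exact: cf.
apply: (@measurable_comp _ _ _ R (g_sigma_algebraType (@open 'rV[R]_d)) R
  (esphere d r) g D f) => //.
  by move=> _ [t Dt <-]; exact: fD.
exact: measurable_funTS.
Qed.

(** The endpoints of the chord with sum t e_i can be made to move continuously
with t, in the plane spanned by e_i and a fixed unit vector z. *)
Lemma chord_sum_axis_measurable i : borel_measurable_on (esphere d r) g ->
  measurable_fun `[0, 2 * r]%classic (fun t : R => chord_sum (t *: 'e_i)).
Proof.
move=> mg.
have [z [zz xz _]] := exists_unit_orthogonal ('e_i : 'rV[R]_d) 'e_i d3.
pose s (t : R) := Num.sqrt (r ^+ 2 - t ^+ 2 / 4).
pose f (c t : R) : 'rV[R]_d := (t / 2) *: 'e_i + (c * s t) *: z.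
have fS t : `[0, 2 * r]%classic t -> esphere d r (f 1 t) /\ esphere d r (f (-1) t).
  rewrite /= in_itv/= => /andP[t0 tr].
  have tt : dotv (t *: 'e_i : 'rV[R]_d) (t *: 'e_i) = t ^+ 2.
    by rewrite !dotv_bilinE dotv_delta eqxx mulr1 expr2.
  have [] := @chord_endpoints (t *: 'e_i) 0 z (dotv0 _) _ (dot0v z) zz.
  - by rewrite dotvZl xz mulr0.
  - by rewrite dot0v addr0 tt lerXn2r// nnegrE; lra.
  rewrite dot0v addr0 tt subr0 addr0 scalerA /f mul1r mulN1r scaleNr.
  by rewrite [t / 2]mulrC; split.
have cf c : continuous (f c).
  apply: continuous_rowP => j t.
  have -> : (fun t => f c t ord0 j) =
      (fun t => t * (2^-1 * ('e_i : 'rV[R]_d) ord0 j) + s t * (c * z ord0 j)).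
    by apply/funext => u; rewrite !mxE; ring.
  have cs : {for t, continuous s}.
    apply: continuous_comp; last exact: sqrt_continuous.
    apply: (@continuousB R R^o); first exact: cst_continuous.
    apply: continuousM; last exact: cst_continuous.
    exact: exprn_continuous.
  by apply: cvgD; apply: cvgM; [exact: cvg_id|exact: cvg_cst|exact: cs|exact: cvg_cst].
apply: (eq_measurable_fun (fun t => g (f 1 t) + g (f (-1) t))).
  move=> t; rewrite inE => tI; have [f1 f2] := fS t tI.
  rewrite -chord_sumE//; congr chord_sum.
  by apply/rowP => j; rewrite !mxE; field.
apply: measurable_funD.
  by apply: measurable_comp_sphere => // t /fS[].
by apply: measurable_comp_sphere => // t /fS[].
Qed.
End Chords.

(** * Affinity on the sphere *)

Theorem theorem5p3 (R : realType) (d : nat) (hd : (3 <= d)%N) (r : R)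
    (hr : 0 < r) (g : 'rV[R]_d -> R)
    (mg : borel_measurable_on (esphere d r) g)
    (hg : forall w w1 w' w1' : 'rV[R]_d,
        esphere d r w -> esphere d r w1 -> esphere d r w' -> esphere d r w1' ->
        w + w1 = w' + w1' ->
        g w + g w1 = g w' + g w1') :
  exists (A : R) (B : 'rV[R]_d),
    forall w : 'rV[R]_d, esphere d r w -> g w = A + dotv B w.
Proof.
pose G := chord_sum r g; pose H x := G x - G 0.
have rho0 : 0 < 2 * r by lra.
have HD x y : dotv x y = 0 -> dotv x x + dotv y y <= (2 * r) ^+ 2 ->
    H (x + y) = H x + H y.
  by move=> xy le; have := chord_sum_orthogonal hd hr hg xy le; rewrite /H /G; lra.
have HN x : dotv x x <= (2 * r) ^+ 2 -> H (- x) = - H x.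
  by move=> le; have := chord_sumN hd hr hg le; rewrite /H /G; lra.
have mH i : measurable_fun `[0, 2 * r]%classic (fun t : R => H (t *: 'e_i)).
  apply: measurable_funB; last exact: measurable_cst.
  exact: chord_sum_axis_measurable.
(* g w = G (2w) / 2 = G 0 / 2 + H (2w) / 2, and H (2w) / 2 = B . w. *)
exists (G 0 / 2), (\row_i (H ((2 * r) *: 'e_i) / (2 * r))) => w sw.
have gw : G (w + w) = g w + g w by exact: chord_sumE.
have := orthogonally_additive_linear hd rho0 HD HN mH (x := w + w).
rewrite !dotv_bilinE ((esphereE _ (ltW hr)).1 sw) => /(_ _)/wrap[].
  by rewrite exprMn; lra.
by rewrite {1}/H gw; lra.
Qed.
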